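(* Let $\alpha\geq 1$. Then: (1) $S_n$ has the maximum value of $\chi_\alpha$ among all $n$-vertex trees; (2) $S_n^+$ has the maximum value of $\chi_\alpha$ among all $n$-vertex unicyclic graphs; (3) $B_1$ has the maximum value of $\chi_\alpha$ among all $n$-vertex bicyclic graphs; (4) for $n\geq 5$, the maximum value of $\chi_\alpha$ among all $n$-vertex tricyclic graphs is attained by $G_4$ or $G_5$; more precisely, $\chi_\alpha(G_4)<\chi_\alpha(G_5)$ for $1<\alpha<2$, $\chi_\alpha(G_4)>\chi_\alpha(G_5)$ for $\alpha>2$, and $\chi_\alpha(G_4)=\chi_\alpha(G_5)$ for $\alpha\in\{1,2\}$; (5) for $n\geq 6$, $H_4$ has the maximum value of $\chi_\alpha$ among all $n$-vertex tetracyclic graphs, and for $n=5$, $H_5$ has the maximum value of $\chi_\alpha$ among all $5$-vertex tetracyclic graphs.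
   Context: All graphs are finite, simple, undirected and connected. A connected graph with $n$ vertices and $m$ edges is a tree, unicyclic, bicyclic, tricyclic, tetracyclic graph if $m=n-1,n,n+1,n+2,n+3$ respectively. The general sum-connectivity index is $\chi_\alpha(G)=\sum_{uv\in E(G)}(d_u+d_v)^\alpha$, $d_u$ the degree of $u$. $S_n$ is the star on $n$ vertices (one center adjacent to $n-1$ leaves). The following graphs are all obtained from $S_n$ by adding edges between leaves: $S_n^+$: add one edge; $B_1$: add two edges sharing a common leaf (i.e. a path $v_1v_2v_3$ on three leaves); $G_4$: join one leaf to three other leaves (requires $n\ge5$); $G_5$: add the three edges of a triangle on three leaves; $H_4$: join one leaf to four other leaves (requires $n\ge 6$); $H_5$: add on four leaves $v_1,v_2,v_3,v_4$ the edges $v_1v_2,v_2v_3,v_3v_1,v_1v_4$ (a triangle with a pendant edge). Statements (1)–(3) are for those $n$ for which the respective graphs exist. *)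

(* Defs.v *)
From HB Require Import structures.
From mathcomp Require Import all_boot all_order all_algebra.
From mathcomp Require Import reals exp.
Set Implicit Arguments. Unset Strict Implicit. Unset Printing Implicit Defensive.
Import Order.TTheory GRing.Theory Num.Theory.
Local Open Scope ring_scope.

Definition simple_graph (n : nat) (e : rel 'I_n) : Prop :=
  symmetric e /\ irreflexive e.

Definition connected_graph (n : nat) (e : rel 'I_n) : Prop :=
  forall i j : 'I_n, connect e i j.

Definition deg (n : nat) (e : rel 'I_n) (i : 'I_n) : nat := #|[pred j | e i j]|.

Definition edge_set (n : nat) (e : rel 'I_n) : {set 'I_n * 'I_n} :=
  [set p : 'I_n * 'I_n | (val p.1 < val p.2)%N && e p.1 p.2].

Definition nedges (n : nat) (e : rel 'I_n) : nat := #|edge_set e|.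

Definition chi (R : realType) (alpha : R) (n : nat) (e : rel 'I_n) : R :=
  \sum_(p in edge_set e) powR ((deg e p.1 + deg e p.2)%:R) alpha.

Definition is_tree (n : nat) (e : rel 'I_n) : Prop :=
  [/\ simple_graph e, connected_graph e & (nedges e).+1 = n].
Definition unicyclic n (e : rel 'I_n) := [/\ simple_graph e, connected_graph e & nedges e = n].
Definition bicyclic n (e : rel 'I_n) := [/\ simple_graph e, connected_graph e & nedges e = n.+1].
Definition tricyclic n (e : rel 'I_n) := [/\ simple_graph e, connected_graph e & nedges e = n.+2].
Definition tetracyclic n (e : rel 'I_n) := [/\ simple_graph e, connected_graph e & nedges e = n.+3].

Definition star_plus (extra : seq (nat * nat)) (n : nat) : rel 'I_n :=
  fun i j => (i != j) &&
    [|| (val i == 0)%N, (val j == 0)%N,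
        (val i, val j) \in extra | (val j, val i) \in extra].

Definition Sn n : rel 'I_n := @star_plus [::] n.
Definition Snplus n : rel 'I_n := @star_plus [:: (1, 2)]%N n.
Definition B1 n : rel 'I_n := @star_plus [:: (1, 2); (2, 3)]%N n.
Definition G4 n : rel 'I_n := @star_plus [:: (1, 2); (1, 3); (1, 4)]%N n.
Definition G5 n : rel 'I_n := @star_plus [:: (1, 2); (2, 3); (3, 1)]%N n.
Definition H4 n : rel 'I_n := @star_plus [:: (1, 2); (1, 3); (1, 4); (1, 5)]%N n.
Definition H5 n : rel 'I_n := @star_plus [:: (1, 2); (2, 3); (3, 1); (1, 4)]%N n.
Arguments Sn n : clear implicits.
Arguments Snplus n : clear implicits.
Arguments B1 n : clear implicits.
Arguments G4 n : clear implicits.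
Arguments G5 n : clear implicits.
Arguments H4 n : clear implicits.
Arguments H5 n : clear implicits.

(* Main.v *)
(** Let [f] be nondecreasing and convex. If [u] and [v] are adjacent, moving
    to [u] all the neighbours of [v] that are not neighbours of [u] preserves
    connectedness and the number of edges, and does not decrease the sum of
    [f (d_i + d_j)] over the edges: the edges moved and those at private
    neighbours of [u] get a larger weight, and at a common neighbour the two
    weights are spread apart with constant sum. Repeating this makes [u]
    adjacent to every other vertex, so that the graph is the cone over a graph
    [H] with [c = m - n + 1] edges, whose sum is
      [(n - 1) f(n) + sum_i (f (n + h_i) - f n) + sum_(ij in H) f (2 + h_i + h_j)]
    where [h_i] are the degrees of [H]. For [c <= 4] this is maximised by a
    case analysis on the largest degree of [H]. What is left are signs of
    finite differences of [x^alpha]; by the mean value theorem two differences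
    can be traded for the factor [alpha (alpha - 1)] and the exponent
    [alpha - 2]. *)

Require Import Defs.
From mathcomp Require Import all_boot all_order all_algebra.
From mathcomp Require Import all_classical topology normedtype derive realfun.
From mathcomp Require Import reals exp.
From mathcomp Require Import zify ring lra.
Set Implicit Arguments.
Unset Strict Implicit.
Unset Printing Implicit Defensive.
Import Order.TTheory GRing.Theory Num.Theory.
Import numFieldNormedType.Exports.
Local Open Scope ring_scope.

(** * Finite differences of real powers *)

Section PowerDifferences.
Context (R : realType).
Implicit Types (a x y : R) (F G : R -> R -> R).

(** The differentiation rule of [x ^ a]; unlike the power function itself, the
    families that satisfy it are closed under finite differences. *)
Definition powerlike F :=
  forall a x, 0 < x -> is_derive x 1 (F a) (a * F (a - 1) x).

Lemma powerlike_powR : powerlike (fun a x => x `^ a).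
Proof. by move=> a x x0; exact: is_derive1_powR. Qed.

Lemma powerlike_shift F : powerlike F -> powerlike (fun a x => F a (x + 1)).
Proof.
move=> FP a x x0; have x10 : 0 < x + 1 by lra.
have dx1 := is_deriveD (is_derive_id x (1 : R)) (is_derive_cst (1 : R) x (1 : R)).
have := @is_derive1_comp _ (F a) (fun y => y + 1) x _ _ (FP a (x + 1) x10) dx1.
by rewrite addr0 mulr1.
Qed.

Lemma powerlikeD F G : powerlike F -> powerlike G ->
  powerlike (fun a x => F a x + G a x).
Proof.
move=> FP GP a x x0; rewrite mulrDr.
exact: (is_deriveD (FP a x x0) (GP a x x0)).
Qed.

Lemma powerlikeB F G : powerlike F -> powerlike G ->
  powerlike (fun a x => F a x - G a x).
Proof.
move=> FP GP a x x0; rewrite mulrBr.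
exact: (is_deriveB (FP a x x0) (GP a x x0)).
Qed.

Lemma powerlike_diff F a x : powerlike F -> 0 < x ->
  exists2 y, x < y & F a (x + 1) - F a x = a * F (a - 1) y.
Proof.
move=> FP x0; have xx1 : x < x + 1 by lra.
have FD y : y \in `[x, x + 1] -> is_derive y 1 (F a) (a * F (a - 1) y).
  by rewrite in_itv /= => /andP[xy _]; apply: FP; lra.
have FC : {within `[x, x + 1], continuous (F a)}%classic.
  by apply: derivable_within_continuous => y /FD yD; exact: ex_derive.
have [y yx ->] := MVT xx1 (fun y yx => FD y (subset_itv_oo_cc yx)) FC.
exists y; first by move: yx; rewrite in_itv => /andP[].
by rewrite addrAC subrr add0r mulr1.
Qed.

(** The first difference of a powerlike family is again powerlike, so the mean value theorem applies
    twice, lowering the exponent by one each time. *)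
Lemma powerlike_diff2 F a x : powerlike F -> 0 < x ->
  exists2 y, x < y &
    F a (x + 1 + 1) - F a (x + 1) - (F a (x + 1) - F a x) =
    a * (a - 1) * F (a - 1 - 1) y.
Proof.
move=> FP x0.
have [y xy ->] := powerlike_diff a (powerlikeB (powerlike_shift FP) FP) x0.
have [|z yz ->] := powerlike_diff (a - 1) FP (x := y); first lra.
by exists z; [lra | rewrite mulrA].
Qed.

Lemma powR_diff2_ge0 a x : 1 <= a -> 0 < x ->
  0 <= (x + 1 + 1) `^ a - (x + 1) `^ a - ((x + 1) `^ a - x `^ a).
Proof.
move=> a1 x0.
have [y xy ->] := powerlike_diff2 a powerlike_powR x0.
by rewrite !mulr_ge0 ?powR_ge0; lra.
Qed.

(** As the second difference of a first difference, the third difference reduces to a first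
    difference at exponent [a - 2], whose sign follows from monotonicity. *)
Lemma powR_diff3 a x : 0 < x -> exists2 y, 0 < y &
  (x + 1 + 1 + 1) `^ a - 3 * (x + 1 + 1) `^ a + 3 * (x + 1) `^ a - x `^ a =
  a * (a - 1) * ((y + 1) `^ (a - 2) - y `^ (a - 2)).
Proof.
move=> x0.
have P := powerlike_powR.
have [y xy] := powerlike_diff2 a (powerlikeB (powerlike_shift P) P) x0.
have -> : a - 1 - 1 = a - 2 by ring.
by move=> E; exists y; [lra | rewrite -E; ring].
Qed.

Lemma lt0_gtr_powR a x y : a < 0 -> 0 < x -> x < y -> y `^ a < x `^ a.
Proof.
move=> a0 x0 xy; have y0 := lt_trans x0 xy.
rewrite -[a]opprK !(powRN _ (- a)) ltf_pV2 ?posrE ?powR_gt0 //.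
by rewrite gt0_ltr_powR ?oppr_gt0 ?nnegrE ?ltW.
Qed.

Lemma powR_diff3_lt0 a x : 1 < a < 2 -> 0 < x ->
  (x + 1 + 1 + 1) `^ a - 3 * (x + 1 + 1) `^ a + 3 * (x + 1) `^ a - x `^ a < 0.
Proof.
move=> a12 x0; have [y y0 ->] := powR_diff3 a x0.
rewrite pmulr_rlt0 ?mulr_gt0 ?subr_lt0 ?lt0_gtr_powR; lra.
Qed.

Lemma powR_diff3_gt0 a x : 2 < a -> 0 < x ->
  0 < (x + 1 + 1 + 1) `^ a - 3 * (x + 1 + 1) `^ a + 3 * (x + 1) `^ a - x `^ a.
Proof.
move=> a2 x0; have [y y0 ->] := powR_diff3 a x0.
rewrite !mulr_gt0 ?subr_gt0 ?gt0_ltr_powR ?nnegrE; lra.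
Qed.

Lemma powR_diff3_eq0 a x : a = 1 \/ a = 2 -> 0 < x ->
  (x + 1 + 1 + 1) `^ a - 3 * (x + 1 + 1) `^ a + 3 * (x + 1) `^ a - x `^ a = 0.
Proof.
move=> a12 x0; have [y y0 ->] := powR_diff3 a x0.
by case: a12 => ->; [ring | rewrite subrr !powRr0; ring].
Qed.

(** The ratio [q = (y + 2) / y] lies between 1 and 2 because [y >= 2], and its power with exponent
    [- a <= 1] is at most [q]. *)
Lemma powR_le_shift2 a y : - 1 <= a <= 0 -> 2 <= y -> y `^ a <= 2 * (y + 2) `^ a.
Proof.
move=> /andP[a1 a0] y2; have y0 : 0 < y by lra.
set q := (y + 2) / y.
have q1 : 1 <= q by rewrite ler_pdivlMr //; lra.
have q2 : q <= 2 by rewrite ler_pdivrMr //; lra.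
have q0 : 0 < q by lra.
have -> : y + 2 = q * y by rewrite /q divfK // gt_eqF.
rewrite powRM ?(ltW q0) ?(ltW y0) // mulrA ler_peMl ?powR_ge0 //.
rewrite -[a]opprK powRN -ler_pdivrMr ?invr_gt0 ?powR_gt0 // mul1r invrK.
by apply: le_trans q2; rewrite ler1_powR //; lra.
Qed.

(** For a nonnegative exponent monotonicity suffices; for a negative one, the powers of [y + 1] and
    [y + 2] are each at least half that of [y]. *)
Lemma powR_shift_ge0 a y : - 1 <= a -> 2 <= y ->
  0 <= (y + 1) `^ a + (y + 1 + 1) `^ a - y `^ a.
Proof.
move=> a1 y2; have y0 : 0 < y by lra.
have [a0|a0] := leP 0 a.
  have : y `^ a <= (y + 1) `^ a by rewrite ge0_ler_powR ?nnegrE; lra.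
  have := powR_ge0 (y + 1 + 1) a; lra.
have := @powR_le_shift2 a y; rewrite a1 ltW // => /(_ isT y2).
have : (y + 2) `^ a < (y + 1) `^ a by rewrite lt0_gtr_powR; lra.
have -> : y + 1 + 1 = y + 2 by ring.
lra.
Qed.

Lemma powR_diff4_ge0 a x : 1 <= a -> 2 <= x ->
  x `^ a + 2 * (x + 1 + 1) `^ a + (x + 1 + 1 + 1) `^ a <=
  3 * (x + 1) `^ a + (x + 1 + 1 + 1 + 1) `^ a.
Proof.
(* The difference of the two sides is the second difference at [x] of
   [(x + 1)^a + (x + 2)^a - x^a]. *)
move=> a1 x2; have x0 : 0 < x by lra.
have P := powerlike_powR; have S := powerlike_shift P.
have M := powerlikeB (powerlikeD S (powerlike_shift S)) P.
have [y xy] := powerlike_diff2 a M x0.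
have : 0 <= a * (a - 1) * ((y + 1) `^ (a - 1 - 1) + (y + 1 + 1) `^ (a - 1 - 1)
    - y `^ (a - 1 - 1)).
  by rewrite !mulr_ge0 ?powR_shift_ge0; lra.
by move=> + E; rewrite -E; lra.
Qed.

End PowerDifferences.

(** * Edge sums, degrees and deletion of a vertex *)

Definition del (n : nat) (v : 'I_n) (e : rel 'I_n) : rel 'I_n :=
  fun i j => [&& i != v, j != v & e i j].

Lemma simple_del (n : nat) (v : 'I_n) (e : rel 'I_n) :
  simple_graph e -> simple_graph (del v e).
Proof.
case=> es ei; split=> [i j|i]; rewrite /del; first by rewrite es andbCA.
by rewrite ei !andbF.
Qed.

Section BigEdges.
Context (V : Type) (idx : V) (op : Monoid.com_law idx).
Context (n : nat) (e : rel 'I_n) (F : 'I_n -> 'I_n -> V).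
Hypotheses (se : simple_graph e) (FC : forall i j, F i j = F j i).

(** Every edge gives two ordered pairs; swapping coordinates exchanges the increasing ones with the
    decreasing ones. *)
Lemma big_adjacency :
  \big[op/idx]_i \big[op/idx]_(j | e i j) F i j =
  op (\big[op/idx]_(p in edge_set e) F p.1 p.2)
     (\big[op/idx]_(p in edge_set e) F p.1 p.2).
Proof.
case: se => es ei.
rewrite pair_big_dep /= (bigID (fun p : 'I_n * 'I_n => (p.1 < p.2)%N)) /=.
congr (op _ _); first by apply: eq_bigl => p; rewrite inE andbC.
rewrite (reindex (fun p : 'I_n * 'I_n => (p.2, p.1))) /=; last first.
  by exists (fun p => (p.2, p.1)) => -[].
apply: eq_big => [[i j]|[i j] _] /=; last exact: FC.
rewrite inE /= -leqNgt leq_eqVlt es andbC.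
by have [/val_inj ->|_] := eqVneq; rewrite ?ei ?andbF.
Qed.

Lemma big_edge_del (v : 'I_n) :
  \big[op/idx]_(p in edge_set e) F p.1 p.2 =
  op (\big[op/idx]_(j | e v j) F v j)
     (\big[op/idx]_(p in edge_set (del v e)) F p.1 p.2).
Proof.
case: se => es ei.
rewrite (bigID (fun p : 'I_n * 'I_n => (p.1 == v) || (p.2 == v))) /=.
congr (op _ _); last first.
  apply: eq_bigl => -[i j]; rewrite !inE /del /= negb_or.
  by case: (i != v); case: (j != v); rewrite ?andbF ?andbT.
(* [h] orients the edge between [v] and [j] increasingly, as in [edge_set]; [h'] recovers the end
   other than [v]. *)
pose h (j : 'I_n) := if (v < j)%N then (v, j) else (j, v).
pose h' (p : 'I_n * 'I_n) := if p.1 == v then p.2 else p.1.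
rewrite (reindex_onto h h') => [|[i j]] /=; last first.
  rewrite inE /h /h' /= => /andP[/andP[]].
  have [->-> //|_ ij _ /eqP jv] := eqVneq i v.
  by rewrite -jv ltnNge ltnW.
apply: eq_big => [j|j]; rewrite inE /h /h'.
  case: (ltnP v j) => vj /=; first by rewrite vj !eqxx /= !andbT.
  rewrite eqxx orbT andbT es.
  have [->|jv] := eqVneq j v; first by rewrite ltnn ei.
  by rewrite eqxx andbT ltn_neqAle vj jv.
by case: (ltnP v j) => //= _ _; rewrite FC.
Qed.

End BigEdges.

Section Degrees.
Context (n : nat) (e : rel 'I_n).
Hypothesis se : simple_graph e.

Lemma sum_deg : (\sum_i deg e i = (nedges e).*2)%N.
Proof.
transitivity (\sum_i \sum_(j | e i j) 1)%N.
  by apply: eq_bigr => i _; rewrite sum1_card.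
by rewrite (big_adjacency addn (F := fun _ _ => 1%N) se) //= sum1_card addnn.
Qed.

Lemma nedges_del (v : 'I_n) : nedges e = (deg e v + nedges (del v e))%N.
Proof.
rewrite /nedges -sum1_card (big_edge_del addn (F := fun _ _ => 1%N) se _ v) //.
by rewrite /= !sum1_card.
Qed.

Lemma deg_del (v i : 'I_n) : i != v -> deg e i = (e v i + deg (del v e) i)%N.
Proof.
move=> iv; rewrite /deg (cardD1 v) inE /= (proj1 se i v); congr addn.
by apply: eq_card => j; rewrite !inE /= /del iv.
Qed.

Lemma deg_del_self (v : 'I_n) : deg (del v e) v = 0%N.
Proof. by apply: eq_card0 => j; rewrite inE /del eqxx. Qed.

Lemma deg_le_nedges (v : 'I_n) : (deg e v <= nedges e)%N.
Proof. by rewrite (nedges_del v) leq_addr. Qed.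

End Degrees.

(** Every edge other than [ij] meets at most one of [i] and [j], so only [ij] is counted twice. *)
Lemma deg_add_le (n : nat) (e : rel 'I_n) (i j : 'I_n) :
  simple_graph e -> e i j -> (deg e i + deg e j <= (nedges e).+1)%N.
Proof.
move=> se eij; have ji : j != i.
  by apply/eqP => ji; move: eij; rewrite ji (proj2 se).
rewrite (deg_del se ji) eij (nedges_del se i) addnCA add1n ltnS leq_add2l.
exact/deg_le_nedges/simple_del.
Qed.

Lemma sum_deg_except (n : nat) (e : rel 'I_n) (v : 'I_n) : simple_graph e ->
  (\sum_(i | i != v) deg (del v e) i = (nedges (del v e)).*2)%N.
Proof.
move=> se; rewrite -sum_deg; last exact: simple_del.
by rewrite [RHS](bigD1 v) //= deg_del_self.
Qed.

(** * Monotone and convex sequences *)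

Section ConvexSequences.
Context (R : realFieldType) (f : nat -> R).
Hypothesis f_mono : forall k, f k <= f k.+1.
Hypothesis f_convex : forall k, f k.+1 - f k <= f k.+2 - f k.+1.

Lemma mono_le (x y : nat) : (x <= y)%N -> f x <= f y.
Proof. exact: (homo_leq (@lexx _ R) (@le_trans _ R) f_mono). Qed.

(** Increments are nondecreasing, so each of the [a] unit steps gains at least as much from [y] as
    from [x]. *)
Lemma convex_spread (x y a : nat) : (x <= y)%N ->
  f (x + a) + f y <= f x + f (y + a).
Proof.
move=> xy; elim: a => [|a IH]; first by rewrite !addn0.
have h : {homo (fun k => f k.+1 - f k) : k l / (k <= l)%N >-> k <= l}.
  exact: (homo_leq (@lexx _ R) (@le_trans _ R) f_convex).
have /h := leq_add xy (leqnn a).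
by rewrite !addnS; lra.
Qed.

End ConvexSequences.

(** * Moving private neighbours along an edge *)

Section Shift.
Context (n : nat) (u v : 'I_n) (e : rel 'I_n).
Hypotheses (se : simple_graph e) (uv : u != v).

Definition moved w := [&& e v w, ~~ e u w & w != u].

Definition shift : rel 'I_n := fun i j =>
  [|| e i j && ~~ ((i == v) && moved j || (j == v) && moved i),
      (i == u) && moved j | (j == u) && moved i].

Let es := proj1 se.
Let ei := proj2 se.

Let moved_u : moved u = false. Proof. by rewrite /moved eqxx !andbF. Qed.
Let moved_v : moved v = false. Proof. by rewrite /moved ei. Qed.

Lemma simple_shift : simple_graph shift.
Proof.
split=> [i j|i]; rewrite /shift.
  by rewrite es [X in ~~ X]orbC; congr orb; rewrite orbC.
rewrite ei /=; have [->|] := eqVneq i u; first by rewrite moved_u.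
by [].
Qed.

Let shiftC := proj1 simple_shift.

Lemma shift_uv : shift u v = e u v.
Proof. by rewrite /shift moved_u moved_v !andbF /= orbF andbT. Qed.

Lemma shift_u w : w != v -> shift u w = e u w || moved w.
Proof.
move=> /negPf wv; rewrite /shift (negPf uv) wv eqxx /= andbT.
by have [->|_] := eqVneq w u; rewrite ?moved_u ?orbF.
Qed.

Lemma shift_v w : w != u -> shift v w = e v w && e u w.
Proof.
move=> wu; rewrite /shift eqxx [v == u]eq_sym (negPf uv) (negPf wu) /=.
rewrite moved_v andbF orbF orbF /moved wu andbT.
by case: (e v w); case: (e u w).
Qed.

Lemma shift_other w x : w != u -> w != v -> x != u -> x != v ->
  shift w x = e w x.
Proof.
move=> /negPf wu /negPf wv /negPf xu /negPf xv.
by rewrite /shift wu wv xu xv /= orbF andbT.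
Qed.

Let deg_split (e' : rel 'I_n) (x : 'I_n) :
  deg e' x = (e' x u + e' x v + \sum_(w | (w != u) && (w != v)) e' x w)%N.
Proof.
transitivity (\sum_w (e' x w : nat))%N.
  rewrite /deg -sum1_card big_mkcond; apply: eq_bigr => w _.
  by rewrite inE; case: e'.
by rewrite (bigD1 u) //= (bigD1 v) 1?eq_sym //= addnA.
Qed.

Let nmoved := (\sum_(w | (w != u) && (w != v)) moved w)%N.

Lemma deg_shift_u : deg shift u = (deg e u + nmoved)%N.
Proof.
rewrite !deg_split (proj2 simple_shift) ei shift_uv -!addnA -big_split /=.
congr (_ + (_ + _))%N; apply: eq_bigr => w /andP[wu wv].
by rewrite shift_u // /moved; case: (e u w); rewrite ?andbF.
Qed.

Lemma deg_shift_v : (deg shift v + nmoved)%N = deg e v.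
Proof.
rewrite !deg_split (proj2 simple_shift) ei shiftC shift_uv es -!addnA -big_split /=.
congr (_ + (_ + _))%N; apply: eq_bigr => w /andP[wu wv].
by rewrite shift_v // /moved wu; case: (e u w); case: (e v w).
Qed.

(** After the shift, a neighbour of [v] other than [u] is a common neighbour of both in [e]. This
    provides the order needed by [convex_spread]. *)
Lemma deg_shift_v_le : (deg shift v <= deg e u)%N.
Proof.
rewrite !deg_split (proj2 simple_shift) ei shiftC shift_uv addn0 add0n leq_add2l.
apply: leq_sum => w /andP[wu wv].
by rewrite shift_v //; case: (e u w); case: (e v w).
Qed.

Lemma deg_shift_other w : w != u -> w != v -> deg shift w = deg e w.
Proof.
move=> wu wv; rewrite !deg_split; congr addn.
  rewrite !(shiftC w) shift_u // shift_v // !(es w) /moved wu.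
  by case: (e u w); case: (e v w).
by apply: eq_bigr => x /andP[xu xv]; rewrite shift_other.
Qed.

Lemma nedges_shift : nedges shift = nedges e.
Proof.
apply: double_inj; rewrite -!sum_deg //; last exact: simple_shift.
rewrite [LHS](bigD1 u) //= [in LHS](bigD1 v) 1?eq_sym //=.
rewrite [RHS](bigD1 u) //= [in RHS](bigD1 v) 1?eq_sym //=.
rewrite deg_shift_u -deg_shift_v !addnA [(_ + nmoved + _)%N]addnAC; congr addn.
by apply: eq_bigr => w /andP[wu wv]; rewrite deg_shift_other.
Qed.

(** A lost edge from [v] to a moved [w] is replaced by the path through [u]; all other edges
    survive. *)
Lemma connected_shift : e u v -> connected_graph e -> connected_graph shift.
Proof.
move=> euv ce i j; move: (ce i j); apply: connect_sub i j => i j.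
have step w : e v w -> connect shift v w.
  move=> evw; have [wu|wu] := boolP (moved w); last first.
    by apply: connect1; rewrite /shift evw (negPf wu) eqxx moved_v !andbF.
  apply: (@connect_trans _ _ u); apply: connect1; rewrite ?(shiftC v) ?shift_uv //.
  by rewrite /shift wu eqxx !orbT.
have sc : connect_sym shift by apply: sym_connect_sym.
have [->|iv] := eqVneq i v; first exact: step.
have [->|jv] := eqVneq j v; first by rewrite es sc; exact: step.
by move=> eij; apply: connect1; rewrite /shift eij (negPf iv) (negPf jv).
Qed.

(** Groups the edges meeting [u] or [v] by their other end [w], so that both graphs can be compared
    term by term. *)
Let big_edge_del2 (R : nmodType) (e' : rel 'I_n) (F : 'I_n -> 'I_n -> R) :
  simple_graph e' -> (forall i j, F i j = F j i) ->
  \sum_(p in edge_set e') F p.1 p.2 =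
  (if e' u v then F u v else 0) +
  \sum_(w | (w != u) && (w != v))
     ((if e' u w then F u w else 0) + (if e' v w then F v w else 0)) +
  \sum_(p in edge_set (del v (del u e'))) F p.1 p.2.
Proof.
move=> se' FC.
rewrite (big_edge_del _ se' FC u) /= (big_edge_del _ (simple_del u se') FC v) /=.
rewrite addrA; congr (_ + _).
rewrite big_split addrA /=; congr (_ + _).
  rewrite big_mkcond (bigD1 u) //= (proj2 se') add0r (bigD1 v) 1?eq_sym //=.
rewrite big_mkcond (bigD1 u) //= {1}/del eqxx andbF add0r (bigD1 v) 1?eq_sym //=.
rewrite {1}/del (proj2 se') !andbF add0r; apply: eq_bigr => w /andP[wu wv].
by rewrite /del wu eq_sym uv.
Qed.

Lemma edge_sum_shift (R : realFieldType) (f : nat -> R) :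
  (forall k, f k <= f k.+1) -> (forall k, f k.+1 - f k <= f k.+2 - f k.+1) ->
  \sum_(p in edge_set e) f (deg e p.1 + deg e p.2)%N <=
  \sum_(p in edge_set shift) f (deg shift p.1 + deg shift p.2)%N.
Proof.
move=> f_mono f_convex.
rewrite (@big_edge_del2 _ e (fun i j => f (deg e i + deg e j)%N)) //; last first.
  by move=> i j; rewrite addnC.
rewrite (@big_edge_del2 _ shift 
  (fun i j => f (deg shift i + deg shift j)%N)); last first.
- by move=> i j; rewrite addnC.
- exact: simple_shift.
rewrite shift_uv; apply: lerD; first apply: lerD.
(* The degrees of [u] and [v] have the same sum before and after. *)
- by rewrite deg_shift_u -deg_shift_v addnAC addnA.
- apply: ler_sum => w /andP[wu wv].
  rewrite /= shift_u // shift_v // (deg_shift_other wu wv) deg_shift_u.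
  rewrite -deg_shift_v /moved wu.
  have := deg_shift_v_le.
  move: (deg shift v) (deg e u) (deg e w) nmoved => b a d k ba.
  (* A common neighbour is settled by convexity; for a private neighbour of [u] or of [v] the degree
     sum does not decrease. *)
  case: (e u w); case: (e v w) => //=; rewrite ?addr0 ?add0r ?lexx //.
  + rewrite addrC addnAC [(a + k + d)%N]addnAC [leRHS]addrC.
    by apply: convex_spread => //; rewrite leq_add2r.
  + by apply: mono_le => //; lia.
  + by apply: mono_le => //; lia.
- have -> : edge_set (del v (del u shift)) = edge_set (del v (del u e)).
    apply/setP => -[i j]; rewrite !inE /del /=.
    have [//|iv] := eqVneq i v; have [//|jv] := eqVneq j v.
    have [//|iu] := eqVneq i u; have [//|ju] := eqVneq j u.
    by rewrite shift_other.
  apply: ler_sum => -[i j]; rewrite !inE /del /= => /and5P[_ iv jv iu /andP[ju _]].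
  by rewrite !deg_shift_other.
Qed.

End Shift.

(** Induction on [n - deg e u]: while some neighbour of [u] has a private neighbour, a shift raises
    the degree of [u]. *)
Lemma exists_universal (R : realFieldType) (f : nat -> R) (n : nat) (u : 'I_n)
    (e : rel 'I_n) :
  (forall k, f k <= f k.+1) -> (forall k, f k.+1 - f k <= f k.+2 - f k.+1) ->
  simple_graph e -> connected_graph e ->
  exists e' : rel 'I_n,
    [/\ simple_graph e', nedges e' = nedges e, forall w, w != u -> e' u w &
        \sum_(p in edge_set e) f (deg e p.1 + deg e p.2)%N <=
        \sum_(p in edge_set e') f (deg e' p.1 + deg e' p.2)%N].
Proof.
move=> f_mono f_convex; have [m] := ubnP (n - deg e u).
elim: m e => // m IH e le_m se ce.
have [/forallP univ|] := boolP [forall w, (w != u) ==> e u w].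
  by exists e; split => // w wu; move: (univ w); rewrite wu.
rewrite negb_forall => /existsP[w0]; rewrite negb_imply => /andP[w0u nuw0].
have [/existsP[v /andP[euv /existsP[w mw]]]|] :=
    boolP [exists v, e u v && [exists w, moved u v e w]].
  have uv : u != v by apply/eqP => uv; move: euv; rewrite uv (proj2 se).
  have [|||e' [se' ne' ue' le']] := IH (shift u v e).
  - suff : (deg e u < deg (shift u v e) u <= n)%N by lia.
    rewrite deg_shift_u // -[X in (X < _)%N]addn0 ltn_add2l.
    rewrite (bigD1 w) /=; last first.
      case/and3P: mw => evw _ -> /=; apply/eqP => wv.
      by move: evw; rewrite wv (proj2 se).
    rewrite mw /=; set d := (_ + _)%N; suff: (d = deg (shift u v e) u)%N.
      by move=> ->; rewrite -[X in (_ <= X)%N]card_ord max_card.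
    rewrite deg_shift_u // (bigD1 w) ?mw //=.
    case/and3P: mw => evw _ -> /=; apply/eqP => wv.
    by move: evw; rewrite wv (proj2 se).
  - exact: simple_shift.
  - exact: connected_shift.
  exists e'; split => //; first by rewrite ne' nedges_shift.
  exact: le_trans (edge_sum_shift se uv f_mono f_convex) le'.
rewrite negb_exists => /forallP no_move.
(* With nothing left to move, the closed neighbourhood of [u] is closed under adjacency, so by
   connectedness it contains every vertex. *)
pose N := [pred w | (w == u) || e u w].
have clN : fingraph.closed e N.
  apply: intro_closed; first exact/sym_connect_sym/(proj1 se).
  move=> x y exy; rewrite !inE => /orP[/eqP <-|eux]; first by rewrite exy orbT.
  have := no_move x; rewrite eux /= negb_exists => /forallP/(_ y).
  by rewrite /moved exy /=; case: eqVneq => //= _; rewrite andbT negbK.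
have := closed_connect clN (ce u w0).
by rewrite !inE eqxx (negPf w0u) (negPf nuw0).
Qed.

(** The sum of [f (d_i + d_j)] over the edges of the cone over [H]. The apex is
    an isolated vertex of [H], whose vertex set is that of the cone; it
    contributes [f n - f n = 0] to the middle sum. *)
Definition cone_sum (R : realFieldType) (f : nat -> R) (n : nat)
    (H : rel 'I_n) : R :=
  (n.-1)%:R * f n + \sum_i (f (n + deg H i)%N - f n) +
  \sum_(p in edge_set H) f (2 + (deg H p.1 + deg H p.2))%N.

Lemma deg_lt (n : nat) (e : rel 'I_n) (i : 'I_n) :
  irreflexive e -> (deg e i < n)%N.
Proof.
move=> ei; suff : (deg e i <= n.-1)%N by have := ltn_ord i; lia.
rewrite -[X in (_ <= X.-1)%N](card_ord n) -(cardC1 i).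
apply/subset_leq_card/fintype.subsetP => j.
by rewrite !inE; apply: contraTneq => ->; rewrite ei.
Qed.

(** * Graphs with a universal vertex *)

Section Cone.
Context (n : nat) (e : rel 'I_n) (z : 'I_n).
Hypotheses (se : simple_graph e) (univ : forall w, w != z -> e z w).

Lemma deg_universal : deg e z = n.-1.
Proof.
rewrite -[in RHS](card_ord n) -(cardC1 z); apply: eq_card => j.
rewrite !inE; have [->|/univ ->] := eqVneq j z; last by [].
exact: (proj2 se).
Qed.

Lemma deg_cone w : w != z -> deg e w = (deg (del z e) w).+1.
Proof. by move=> wz; rewrite (deg_del se wz) univ. Qed.

Lemma nedges_cone : nedges e = (n.-1 + nedges (del z e))%N.
Proof. by rewrite (nedges_del se z) deg_universal. Qed.

(** If [h] is the degree of [j] after deleting [z], the edge [zj] has degree sum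
    [(n - 1) + (h + 1) = n + h]; on other edges both ends gain one from [z]. *)
Lemma edge_sum_cone (R : realFieldType) (f : nat -> R) :
  \sum_(p in edge_set e) f (deg e p.1 + deg e p.2)%N = cone_sum f (del z e).
Proof.
have n0 : (0 < n)%N by case: (n) z => // -[].
rewrite (big_edge_del _ se (F := fun i j => f (deg e i + deg e j)%N) _ z) /=; last first.
  by move=> i j; rewrite addnC.
congr (_ + _); last first.
  apply: eq_bigr => -[i j]; rewrite inE /= => /andP[_ /and3P[iz jz _]].
  by rewrite !deg_cone // addnS addSn.
rewrite [in RHS](bigD1 z) //= deg_del_self addn0 subrr add0r.
transitivity (\sum_(j | j != z) (f n + (f (n + deg (del z e) j)%N - f n))).
  apply: eq_big => [j|j ezj].
    by have [->|/univ ->] := eqVneq j z; first exact: (proj2 se).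
  have jz : j != z by apply/eqP => jz; move: ezj; rewrite jz (proj2 se).
  by rewrite deg_universal deg_cone // addnS -addSn prednK // addrC subrK.
by rewrite big_split /= sumr_const cardC1 card_ord mulr_natl.
Qed.

End Cone.

(** * Bounds on degree sums and edge sums *)

Section DegreeSums.
Context (R : realFieldType) (g : nat -> R) (n : nat) (H : rel 'I_n).
Hypothesis sH : simple_graph H.

(** A linear majorant of [g] on the occurring degrees reduces the sum to the handshake identity. *)
Lemma sum_deg_le_chord (s : R) : (forall i, g (deg H i) <= (deg H i)%:R * s) ->
  \sum_i g (deg H i) <= (nedges H).*2%:R * s.
Proof.
move=> gs; rewrite -sum_deg // natr_sum mulr_suml.
exact: ler_sum.
Qed.

(** [a] is the adjacency with [v] and [r] the degree after deleting [v]. *)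
Lemma sum_deg_le_at (v : 'I_n) (s : R) :
  (forall (a : bool) r, (r + deg H v <= nedges H)%N ->
     g (a + r)%N <= a%:R * g 1%N + r%:R * s) ->
  \sum_i g (deg H i) <=
  g (deg H v) + (deg H v)%:R * g 1%N + (nedges H - deg H v).*2%:R * s.
Proof.
move=> gs; rewrite (bigD1 v) //= -addrA lerD2l.
have -> : (nedges H - deg H v)%N = nedges (del v H) by rewrite (nedges_del sH v) addKn.
have -> : deg H v = (\sum_(i | i != v) H v i)%N.
  rewrite /deg -sum1_card big_mkcond (bigD1 v) //= inE (proj2 sH) add0n.
  by apply: eq_bigr => i _; rewrite inE; case: (H v i).
rewrite -sum_deg_except // !natr_sum !mulr_suml -big_split /=.
apply: ler_sum => i iv; rewrite (deg_del sH iv); apply: gs.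
by rewrite (nedges_del sH v) addnC leq_add2l; exact/deg_le_nedges/simple_del.
Qed.

(** The bound is sharp for stars and for the triangle, the two competitors with three edges. *)
Lemma edge_sum_le : (forall k, g k <= g k.+1) ->
  \sum_(p in edge_set H) g (deg H p.1 + deg H p.2)%N <=
  (nedges H)%:R * g (nedges H).+1.
Proof.
move=> g_mono; rewrite mulr_natl -sumr_const.
apply: ler_sum => -[i j]; rewrite inE /= => /andP[_ Hij].
by apply: (mono_le g_mono); exact: deg_add_le.
Qed.

Lemma edge_sum_le_max (k : nat) : (forall k, g k <= g k.+1) ->
  (forall i, deg H i <= k)%N ->
  \sum_(p in edge_set H) g (deg H p.1 + deg H p.2)%N <= (nedges H)%:R * g (k + k)%N.
Proof.
move=> g_mono Hk; rewrite mulr_natl -sumr_const.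
by apply: ler_sum => -[i j] _; apply: (mono_le g_mono); exact: leq_add.
Qed.

(** Only one edge avoids [v]. It raises at most two neighbours of [v] from degree 1 to degree 2, and
    its own ends have degree at most 2, whence [g 4]. *)
Lemma edge_sum_le_almost_star (v : 'I_n) : (forall k, g k <= g k.+1) ->
  nedges H = (deg H v).+1 ->
  \sum_(p in edge_set H) g (deg H p.1 + deg H p.2)%N <=
  (deg H v)%:R * g (deg H v + 1)%N +
    2 * (g (deg H v + 2)%N - g (deg H v + 1)%N) + g 4%N.
Proof.
move=> g_mono cv; have c1 : nedges (del v H) = 1%N.
  by apply/eqP; rewrite -(eqn_add2l (deg H v)) -nedges_del // cv addn1.
have sd := simple_del v sH.
have r1 i : (deg (del v H) i <= 1)%N by rewrite -c1 deg_le_nedges.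
rewrite (big_edge_del _ sH (F := fun i j => g (deg H i + deg H j)%N) _ v) /=; last first.
  by move=> i j; rewrite addnC.
apply: lerD; last first.
  have -> : g 4%N = (nedges (del v H))%:R * g 4%N by rewrite c1 mul1r.
  rewrite mulr_natl -sumr_const.
  apply: ler_sum => -[i j]; rewrite inE /= => /andP[_ dij].
  have /and3P[iv jv _] := dij.
  apply: (mono_le g_mono); rewrite (deg_del sH iv) (deg_del sH jv).
  by have := deg_add_le sd dij; rewrite c1; case: (H v i); case: (H v j) => /=; lia.
(* A neighbour of [v] has degree 1 or 2, so its weight is affine in its degree after the
   deletion. *)
have E i : H v i -> g (deg H v + deg H i)%N =
    g (deg H v + 1)%N +
    (deg (del v H) i)%:R * (g (deg H v + 2)%N - g (deg H v + 1)%N).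
  move=> Hvi; have iv : i != v by apply/eqP => iv; move: Hvi; rewrite iv (proj2 sH).
  rewrite (deg_del sH iv) Hvi; have := r1 i.
  by case: (deg _ i) => [|[|]] // _; rewrite ?addn0 ?mul0r ?addr0 // mul1r addrC subrK.
rewrite (eq_bigr _ E) big_split /= sumr_const mulr_natl lerD2l -mulr_suml -natr_sum.
rewrite ler_wpM2r ?subr_ge0 ?addn2 ?addn1 ?g_mono // ler_nat.
rewrite -[X in (_ <= X)%N]/(1.*2)%N -c1 -(sum_deg_except v sH).
rewrite big_mkcond [X in (_ <= X)%N]big_mkcond; apply: leq_sum => i _.
have [->|_] := eqVneq i v; first by rewrite (proj2 sH).
by case: ifP.
Qed.

End DegreeSums.

(** * Graphs given by edge lists *)

Definition listed (s : seq (nat * nat)) (n : nat) : rel 'I_n := fun i j =>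
  (i != j) && (((val i, val j) \in s) || ((val j, val i) \in s)).

(** Each edge is listed once, in either orientation, and none contains the
    centre [0] of the star. *)
Fixpoint edge_list (n : nat) (s : seq (nat * nat)) : bool :=
  if s is q :: s' then
    [&& (0 < q.1 < n)%N, (0 < q.2 < n)%N, q.1 != q.2, q \notin s',
        (q.2, q.1) \notin s' & edge_list n s']
  else true.

Definition list_deg (s : seq (nat * nat)) (k : nat) : nat :=
  \sum_(q <- s) ((q.1 == k) + (q.2 == k)).

Lemma simple_listed (s : seq (nat * nat)) (n : nat) : simple_graph (@listed s n).
Proof.
by split=> [i j|i]; rewrite /listed ?eqxx // eq_sym; congr andb; rewrite orbC.
Qed.

Lemma big_listed (V : Type) (idx : V) (op : Monoid.com_law idx) (n : nat)
    (s : seq (nat * nat)) (F : nat -> nat -> V) :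
  edge_list n s -> (forall i j, F i j = F j i) ->
  \big[op/idx]_(p in edge_set (@listed s n)) F (val p.1) (val p.2) =
  \big[op/idx]_(q <- s) F q.1 q.2.
Proof.
move=> + FC; elim: s => [_|[a b] s IH /=].
  by rewrite big_nil big_pred0 // => -[i j]; rewrite inE /listed /= !andbF.
case/and5P => /andP[_ an] /andP[_ bn] ab nab /andP[nba /IH {}IH].
pose p := if (a < b)%N then (Ordinal an, Ordinal bn) else (Ordinal bn, Ordinal an).
rewrite big_cons -IH /= (_ : edge_set _ = p |: edge_set (@listed s n)).
  rewrite big_setU1 /=.
    by congr (op _ _); rewrite /p; case: ifP => _ //=; rewrite FC.
  by rewrite inE /p /listed; case: ifP => _ /=; rewrite (negPf nab) (negPf nba) !andbF.
apply/setP => -[i j]; rewrite !inE /listed /p /= !inE !xpair_eqE.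
have [ij|ij] := ltnP i j; last first.
  by rewrite /= orbF; case: ifP => c; rewrite xpair_eqE -!val_eqE /=; lia.
have -> /= : i != j by rewrite -val_eqE neq_ltn ij.
case: ((_, _) \in s); case: ((_, _) \in s); rewrite ?orbT ?orbF //.
by case: ifP => c; rewrite xpair_eqE -!val_eqE /=; lia.
Qed.

Lemma nedges_listed (n : nat) (s : seq (nat * nat)) :
  edge_list n s -> nedges (@listed s n) = size s.
Proof.
move=> ws; rewrite /nedges -sum1_card (big_listed addn (F := fun _ _ => 1%N)) //=.
by rewrite sum1_size.
Qed.

Lemma deg_listed (n : nat) (s : seq (nat * nat)) (i : 'I_n) :
  edge_list n s -> deg (@listed s n) i = list_deg s i.
Proof.
move=> ws; have sl := simple_listed s n.
pose F a b := ((a == i :> nat) + (b == i :> nat))%N.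
have FC a b : F a b = F b a by rewrite /F addnC.
rewrite /list_deg -(big_listed addn (F := F) ws FC) /=.
rewrite (big_edge_del _ sl (F := fun a b => F a b) _ i) //= {FC}/F.
rewrite [X in (_ + X)%N]big1 => [|[a b]]; last first.
  by rewrite inE => /andP[_ /and3P[/negPf ai /negPf bi _]] /=; rewrite !val_eqE ai bi.
rewrite addn0 /deg -sum1_card; apply: eq_bigr => j.
rewrite inE eqxx => /andP[/negPf ij _].
by rewrite val_eqE eq_sym ij.
Qed.

(** Vertices from [m] on are isolated and contribute [f n - f n = 0], so the middle sum has a length
    independent of [n]. *)
Lemma cone_sum_listed (R : realFieldType) (f : nat -> R) (n m : nat)
    (s : seq (nat * nat)) :
  edge_list n s -> (m <= n)%N -> (forall k, (m <= k)%N -> list_deg s k = 0%N) ->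
  cone_sum f (@listed s n) =
  (n.-1)%:R * f n + \sum_(0 <= k < m) (f (n + list_deg s k)%N - f n) +
  \sum_(q <- s) f (2 + (list_deg s q.1 + list_deg s q.2))%N.
Proof.
move=> ws mn s0; rewrite /cone_sum; congr (_ + _ + _).
  rewrite (eq_bigr (fun i : 'I_n => f (n + list_deg s i)%N - f n)); last first.
    by move=> i _; rewrite deg_listed.
  rewrite -(big_mkord xpredT (fun k => f (n + list_deg s k)%N - f n)).
  rewrite (big_cat_nat _ mn) //= [X in _ + X]big_nat_cond [X in _ + X]big1 ?addr0 //.
  by move=> k /andP[/andP[mk _] _]; rewrite s0 // addn0 subrr.
rewrite -(big_listed +%R
  (F := fun a b => f (2 + (list_deg s a + list_deg s b))%N) ws) /=.
  by apply: eq_bigr => p _; rewrite !deg_listed.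
by move=> i j; rewrite [(list_deg s i + _)%N]addnC.
Qed.

(** * Stars with added edges *)

Section StarPlus.
Context (n : nat) (s : seq (nat * nat)).
Hypotheses (n0 : (0 < n)%N) (ws : edge_list n s).
Let e := @star_plus s n.
Let z : 'I_n := Ordinal n0.

Lemma simple_star_plus : simple_graph e.
Proof.
split=> [i j|i]; rewrite /e /star_plus ?eqxx // eq_sym orbCA.
by congr (_ && (_ || (_ || _))); rewrite orbC.
Qed.

Lemma star_plus_universal w : w != z -> e z w.
Proof. by move=> wz; rewrite /e /star_plus eq_sym wz. Qed.

Lemma connected_star_plus : connected_graph e.
Proof.
have ez i : connect e z i.
  by have [->|/star_plus_universal/connect1] := eqVneq i z.
have sc : connect_sym e by exact/sym_connect_sym/(proj1 simple_star_plus).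
by move=> i j; apply: connect_trans (ez j); rewrite sc.
Qed.

(** The centre 0 occurs in no listed pair, so its removal leaves exactly the listed edges. *)
Lemma del_star_plus : del z e =2 @listed s n.
Proof.
have ns k : ((0%N, k) \notin s) && ((k, 0%N) \notin s).
  elim: (s) ws => //= -[a b] s' IH /and5P[/andP[a0 _] /andP[b0 _] _ _ /andP[_ /IH]].
  rewrite !inE !xpair_eqE => /andP[/negPf -> /negPf ->].
  by move: a0 b0 => /=; lia.
move=> i j; rewrite /del /e /star_plus /listed -!val_eqE /=.
have [i0|_] /= := eqVneq (val i) 0%N.
  by rewrite i0; case/andP: (ns j) => /negPf -> /negPf ->; rewrite andbF.
have [j0|_] //= := eqVneq (val j) 0%N.
by rewrite j0; case/andP: (ns i) => /negPf -> /negPf ->; rewrite andbF.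
Qed.

Let edge_set_del : edge_set (del z e) = edge_set (@listed s n).
Proof. by apply/setP => p; rewrite !inE del_star_plus. Qed.

Lemma nedges_star_plus : nedges e = (n.-1 + size s)%N.
Proof.
rewrite (nedges_cone simple_star_plus star_plus_universal).
by rewrite /nedges edge_set_del -/(nedges _) nedges_listed.
Qed.

Lemma edge_sum_star_plus (R : realFieldType) (f : nat -> R) :
  \sum_(p in edge_set e) f (deg e p.1 + deg e p.2)%N = cone_sum f (@listed s n).
Proof.
rewrite (edge_sum_cone simple_star_plus star_plus_universal).
have E i : deg (del z e) i = deg (@listed s n) i.
  by apply: eq_card => j; rewrite !inE del_star_plus.
rewrite /cone_sum edge_set_del.
congr (_ + _ + _); first by apply: eq_bigr => i _; rewrite E.
by apply: eq_bigr => p _; rewrite !E.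
Qed.

End StarPlus.

(** * Maximal cone sums for at most four edges *)

Section ConeBounds.
Context (R : realFieldType) (f : nat -> R).
Hypothesis f_mono : forall k, f k <= f k.+1.
Hypothesis f_convex : forall k, f k.+1 - f k <= f k.+2 - f k.+1.

Lemma edge_sum_le_cone (n c : nat) (e : rel 'I_n) : (0 < n)%N ->
  simple_graph e -> connected_graph e -> nedges e = (n.-1 + c)%N ->
  exists H : rel 'I_n, [/\ simple_graph H, nedges H = c,
    forall i, (deg H i <= n - 2)%N &
    \sum_(p in edge_set e) f (deg e p.1 + deg e p.2)%N <= cone_sum f H].
Proof.
move=> n0 se ce ne; pose z := Ordinal n0.
have [e' [se' ne' univ le_e']] := exists_universal z f_mono f_convex se ce.
exists (del z e'); split; first exact: simple_del.
- by apply: (@addnI n.-1); rewrite -(nedges_cone se' univ) ne' ne.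
- move=> i; have [->|iz] := eqVneq i z; first by rewrite deg_del_self.
  by have := deg_lt i (proj2 se'); rewrite (deg_cone se' univ iz); lia.
- by rewrite -(edge_sum_cone se' univ).
Qed.

Section Bounds.
Context (n : nat) (H : rel 'I_n).
Hypothesis sH : simple_graph H.
Let g k := f (n + k)%N - f n.

Let g0 : g 0 = 0. Proof. by rewrite /g addn0 subrr. Qed.
Let g_step k : g k.+1 - g k <= g k.+2 - g k.+1.
Proof. by have := f_convex (n + k); rewrite /g !addnS; lra. Qed.
Let f2_mono k : f (2 + k)%N <= f (2 + k.+1)%N. Proof. by rewrite addnS. Qed.

Let edges_le c : nedges H = c ->
  \sum_(p in edge_set H) f (2 + (deg H p.1 + deg H p.2))%N <= c%:R * f (c + 3)%N.
Proof.
move=> Hc; have := edge_sum_le sH f2_mono.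
by rewrite Hc -[(2 + c.+1)%N]addSnnS addnC.
Qed.

Let chord k : (k <= 2)%N -> g k <= k%:R * (g 2 / 2).
Proof.
have := g_step 0; rewrite g0; case: k => [|[|[|]]] // h _; rewrite ?g0; lra.
Qed.

Lemma cone_sum_le0 : nedges H = 0%N -> cone_sum f H <= (n.-1)%:R * f n.
Proof.
move=> H0.
have h i : deg H i = 0%N by apply/eqP; rewrite -leqn0 -H0 deg_le_nedges.
have := edges_le H0; rewrite mul0r.
rewrite /cone_sum [X in _ + X + _]big1 => [|i _]; first lra.
by rewrite h addn0 subrr.
Qed.

Let deg_le i : (deg H i <= nedges H)%N. Proof. exact: deg_le_nedges. Qed.

Let low_degrees s : (forall i, g (deg H i) <= (deg H i)%:R * s) ->
  \sum_i g (deg H i) <= (nedges H).*2%:R * s.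
Proof. exact: sum_deg_le_chord. Qed.

Let star_degrees v : deg H v = nedges H ->
  \sum_i g (deg H i) <= g (nedges H) + (nedges H)%:R * g 1.
Proof.
move=> Hv; have := @sum_deg_le_at _ g n H sH v 0.
rewrite Hv subnn mul0r addr0; apply => a r.
rewrite -[X in (_ <= X)%N]add0n leq_add2r leqn0.
by move=> /eqP ->; rewrite addn0 mul0r addr0; case: a; rewrite ?mul0r ?mul1r ?g0.
Qed.

Lemma cone_sum_le1 : nedges H = 1%N ->
  cone_sum f H <= (n.-1)%:R * f n + 2 * (f (n + 1)%N - f n) + f 4.
Proof.
move=> H1; have := edges_le H1; rewrite mul1r.
have := @low_degrees (g 1); rewrite H1 => L.
have : \sum_i g (deg H i) <= 2 * g 1.
  apply: L => i; have := deg_le i; rewrite H1.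
  by case: deg => [|[|]] // _; rewrite ?mul0r ?mul1r ?g0.
rewrite /cone_sum /g; lra.
Qed.

(** Either a vertex of degree 2 makes [H] a star, or all degrees are at most 1 and convexity gives
    [4 * g 1 <= g 2 + 2 * g 1]. *)
Lemma cone_sum_le2 : nedges H = 2%N ->
  cone_sum f H <= (n.-1)%:R * f n + (f (n + 2)%N - f n) + 2 * (f (n + 1)%N - f n)
     + 2 * f 5.
Proof.
move=> H2; have := edges_le H2.
suff : \sum_i g (deg H i) <= g 2 + 2 * g 1 by rewrite /cone_sum /g; lra.
have [/existsP[v /eqP Hv]|] := boolP [exists v, deg H v == 2%N].
  by have := star_degrees (v := v); rewrite H2; apply.
rewrite negb_exists => /forallP h.
have := @low_degrees (g 1); rewrite H2 => L.
have : \sum_i g (deg H i) <= 4 * g 1.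
  apply: L => i; have := deg_le i; have := h i; rewrite H2.
  by case: deg => [|[|[|]]] // _ _; rewrite ?mul0r ?mul1r ?g0.
have := g_step 0; rewrite g0; lra.
Qed.

(** A vertex of degree 3 forces a star; otherwise the degrees are at most 2, and the chord of [g]
    from 0 to 2 gives the value of the triangle. *)
Lemma cone_sum_le3 : nedges H = 3%N ->
  cone_sum f H <= (n.-1)%:R * f n + (f (n + 3)%N - f n) + 3 * (f (n + 1)%N - f n)
     + 3 * f 6 \/
  cone_sum f H <= (n.-1)%:R * f n + 3 * (f (n + 2)%N - f n) + 3 * f 6.
Proof.
move=> H3; have E := edges_le H3.
have [/existsP[v /eqP Hv]|] := boolP [exists v, deg H v == 3%N].
  have := star_degrees (v := v); rewrite H3 /g => /(_ Hv) D.
  by left; move: E; rewrite /cone_sum; lra.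
rewrite negb_exists => /forallP h.
have := @low_degrees (g 2 / 2); rewrite H3 => L.
have : \sum_i g (deg H i) <= 6 * (g 2 / 2).
  by apply: L => i; apply: chord; have := deg_le i; have := h i; rewrite H3; lia.
by rewrite /g => D; right; move: E; rewrite /cone_sum; lra.
Qed.

Let deg3_degrees v : nedges H = 4%N -> deg H v = 3%N ->
  \sum_i g (deg H i) <= g 3 + 2 * g 2 + g 1.
Proof.
(* The slope [g 2 - g 1] is exact at a neighbour of [v] on the one edge avoiding [v]; at a
   non-neighbour on that edge convexity suffices. *)
move=> H4 Hv; have := @sum_deg_le_at _ g n H sH v (g 2 - g 1).
rewrite H4 Hv => L.
have : \sum_i g (deg H i) <= g 3 + 3 * g 1 + 2 * (g 2 - g 1).
  apply: L => a r; have := g_step 0; rewrite g0.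
  case: r => [|[|r]] step r3; last lia.
    by case: a => /=; rewrite ?addn0 ?add0n ?g0; lra.
  by case: a => /=; rewrite ?addn0 ?add0n ?g0; lra.
lra.
Qed.

Let deg2_degrees : nedges H = 4%N -> (forall i, deg H i <= 2)%N ->
  \sum_i g (deg H i) <= 4 * g 2.
Proof.
move=> H4 h; have := @low_degrees (g 2 / 2); rewrite H4 => L.
have : \sum_i g (deg H i) <= 8 * (g 2 / 2) by apply: L => i; exact: chord.
lra.
Qed.

(** The inequality assumed says [g 3 + 2 * g 2 <= 3 * g 1 + g 4], which settles largest degree 3.
    For degrees at most 2, convexity gives [4 * g 2 <= g 3 + 2 * g 2 + g 1], and the same inequality
    applies. *)
Lemma cone_sum_le4 : nedges H = 4%N ->
  f n + 2 * f (n + 2)%N + f (n + 3)%N <= 3 * f (n + 1)%N + f (n + 4)%N ->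
  cone_sum f H <= (n.-1)%:R * f n + (f (n + 4)%N - f n) + 4 * (f (n + 1)%N - f n)
     + 4 * f 7.
Proof.
move=> H4 P; have := edges_le H4.
suff : \sum_i g (deg H i) <= g 4 + 4 * g 1 by rewrite /cone_sum /g; lra.
have [/existsP[v /eqP Hv]|] := boolP [exists v, deg H v == 4%N].
  by have := star_degrees (v := v); rewrite H4; apply.
rewrite negb_exists => /forallP h4.
have [/existsP[v /eqP Hv]|] := boolP [exists v, deg H v == 3%N].
  by have := deg3_degrees H4 Hv; move: P; rewrite /g; lra.
rewrite negb_exists => /forallP h3.
have := deg2_degrees H4; have := g_step 1; move: P; rewrite /g => P step L.
have : \sum_i (f (n + deg H i)%N - f n) <= 4 * (f (n + 2)%N - f n).
  by apply: L => i; have := deg_le i; have := h4 i; have := h3 i; rewrite H4; lia.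
lra.
Qed.

(** Serves the case [n = 5]. At a vertex of degree 3 exactly one edge is missing, as in
    [edge_sum_le_almost_star]; with degrees at most 2 every edge weighs at most [f 6]. *)
Lemma cone_sum_le4_deg3 : nedges H = 4%N -> (forall i, deg H i <= 3)%N ->
  cone_sum f H <= (n.-1)%:R * f n + (f (n + 3)%N - f n) + 2 * (f (n + 2)%N - f n) +
     (f (n + 1)%N - f n) + 2 * f 7 + 2 * f 6.
Proof.
move=> H4 h; have [/existsP[v /eqP Hv]|] := boolP [exists v, deg H v == 3%N].
  have := deg3_degrees H4 Hv.
  have := edge_sum_le_almost_star sH (v := v) f2_mono; rewrite H4 Hv => /(_ erefl).
  rewrite /cone_sum /g /=; lra.
rewrite negb_exists => /forallP h3.
have h2 i : (deg H i <= 2)%N by have := h3 i; have := h i; lia.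
have := deg2_degrees H4 h2; have := g_step 1; have := edge_sum_le_max f2_mono h2.
have := f_mono 6; rewrite H4 /cone_sum /g /=; lra.
Qed.

End Bounds.
End ConeBounds.

(** * The power sequence and the values at the extremal graphs *)

Section Chi.
Context (R : realType) (alpha : R).
Hypothesis alpha1 : 1 <= alpha.
Let f (k : nat) : R := k%:R `^ alpha.

Lemma natpow_mono k : f k <= f k.+1.
Proof.
by rewrite ge0_ler_powR ?nnegrE ?ler0n ?ler_nat // (le_trans ler01 alpha1).
Qed.

Lemma natpow_convex k : f k.+1 - f k <= f k.+2 - f k.+1.
Proof.
case: k => [|k].
  (* The second difference bound needs a positive base, so 0 is treated apart: the claim is
     [1 - 0 <= 2 ^ alpha - 1]. *)
  have : (2 : R) <= 2 `^ alpha by rewrite le1r_powR //; lra.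
  have a0 : 0 < alpha := lt_le_trans ltr01 alpha1.
  rewrite /f powR1 powR0 ?gt_eqF //; lra.
have k0 : 0 < k.+1%:R :> R by rewrite ltr0n.
by have := powR_diff2_ge0 alpha1 k0; rewrite /f -!natr1; lra.
Qed.

Lemma natpow_diff4 n : (2 <= n)%N ->
  f n + 2 * f (n + 2)%N + f (n + 3)%N <= 3 * f (n + 1)%N + f (n + 4)%N.
Proof.
rewrite -(ler_nat R) => n2; have := powR_diff4_ge0 alpha1 n2.
by rewrite /f !addnS addn0 -!natr1.
Qed.

Lemma chi_le_cone (n c : nat) (e : rel 'I_n) : (0 < n)%N ->
  simple_graph e -> connected_graph e -> nedges e = (n.-1 + c)%N ->
  exists H : rel 'I_n, [/\ simple_graph H, nedges H = c,
    forall i, (deg H i <= n - 2)%N & chi alpha e <= cone_sum f H].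
Proof. exact: (edge_sum_le_cone natpow_mono natpow_convex). Qed.

Lemma star_plus_cyclic (n : nat) (s : seq (nat * nat)) :
  (0 < n)%N -> edge_list n s ->
  [/\ simple_graph (@star_plus s n), connected_graph (@star_plus s n) &
      nedges (@star_plus s n) = (n.-1 + size s)%N].
Proof.
move=> n0 ws; split.
- exact: simple_star_plus.
- exact: connected_star_plus.
- exact: nedges_star_plus.
Qed.

Lemma chi_star_plus (n m : nat) (s : seq (nat * nat)) :
  (0 < n)%N -> edge_list n s -> (m <= n)%N ->
  (forall k, (m <= k)%N -> list_deg s k = 0%N) ->
  chi alpha (@star_plus s n) =
  (n.-1)%:R * f n + \sum_(0 <= k < m) (f (n + list_deg s k)%N - f n) +
  \sum_(q <- s) f (2 + (list_deg s q.1 + list_deg s q.2))%N.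
Proof.
move=> n0 ws mn s0; rewrite -(@cone_sum_listed R f n m s) //.
exact: (edge_sum_star_plus n0 ws f).
Qed.

Let list_deg_nil k : list_deg [::] k = 0%N.
Proof. by rewrite /list_deg big_nil. Qed.
Let list_deg_cons a b s k :
  list_deg ((a, b) :: s) k = ((a == k) + (b == k) + list_deg s k)%N.
Proof. by rewrite /list_deg big_cons. Qed.
Let list_degE := (list_deg_nil, list_deg_cons).

(** [m] exceeds every vertex of the added edges, so the middle sum unfolds to [m] explicit terms. *)
Ltac chi_value m :=
  move=> ?; rewrite (@chi_star_plus _ m) /=;
    [|lia..|by move=> k; rewrite !list_degE; lia];
  rewrite unlock /= ?list_degE /=.

Lemma chi_Sn n : (0 < n)%N -> chi alpha (Sn n) = (n.-1)%:R * f n.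
Proof. chi_value 0%N. by rewrite !addr0. Qed.

Lemma chi_Snplus n : (3 <= n)%N -> chi alpha (Snplus n) =
  (n.-1)%:R * f n + 2 * (f (n + 1)%N - f n) + f 4.
Proof. chi_value 3%N. by rewrite ?addn0; lra. Qed.

Lemma chi_B1 n : (4 <= n)%N -> chi alpha (B1 n) =
  (n.-1)%:R * f n + (f (n + 2)%N - f n) + 2 * (f (n + 1)%N - f n) + 2 * f 5.
Proof. chi_value 4%N. by rewrite ?addn0; lra. Qed.

Lemma chi_G4 n : (5 <= n)%N -> chi alpha (G4 n) =
  (n.-1)%:R * f n + (f (n + 3)%N - f n) + 3 * (f (n + 1)%N - f n) + 3 * f 6.
Proof. chi_value 5%N. by rewrite ?addn0; lra. Qed.

Lemma chi_G5 n : (4 <= n)%N -> chi alpha (G5 n) =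
  (n.-1)%:R * f n + 3 * (f (n + 2)%N - f n) + 3 * f 6.
Proof. chi_value 4%N. by rewrite ?addn0; lra. Qed.

Lemma chi_H4 n : (6 <= n)%N -> chi alpha (H4 n) =
  (n.-1)%:R * f n + (f (n + 4)%N - f n) + 4 * (f (n + 1)%N - f n) + 4 * f 7.
Proof. chi_value 6%N. by rewrite ?addn0; lra. Qed.

Lemma chi_H5 n : (5 <= n)%N -> chi alpha (H5 n) =
  (n.-1)%:R * f n + (f (n + 3)%N - f n) + 2 * (f (n + 2)%N - f n) +
     (f (n + 1)%N - f n) + 2 * f 7 + 2 * f 6.
Proof. chi_value 5%N. by rewrite ?addn0; lra. Qed.

End Chi.

(** * Comparison with the extremal graphs *)

Theorem theorem6 (R : realType) (alpha : R) (halpha : 1 <= alpha) :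
  (* (1) trees *)
  (forall n : nat, (0 < n)%N ->
     is_tree (Sn n) /\
     forall e : rel 'I_n, is_tree e -> chi alpha e <= chi alpha (Sn n)) /\
  (* (2) unicyclic *)
  (forall n : nat, (3 <= n)%N ->
     unicyclic (Snplus n) /\
     forall e : rel 'I_n, unicyclic e -> chi alpha e <= chi alpha (Snplus n)) /\
  (* (3) bicyclic *)
  (forall n : nat, (4 <= n)%N ->
     bicyclic (B1 n) /\
     forall e : rel 'I_n, bicyclic e -> chi alpha e <= chi alpha (B1 n)) /\
  (* (4) tricyclic *)
  (forall n : nat, (5 <= n)%N ->
     tricyclic (G4 n) /\ tricyclic (G5 n) /\
         (forall e : rel 'I_n, tricyclic e ->
            chi alpha e <= Num.max (chi alpha (G4 n)) (chi alpha (G5 n))) /\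
         (1 < alpha < 2 -> chi alpha (G4 n) < chi alpha (G5 n)) /\
         (2 < alpha -> chi alpha (G5 n) < chi alpha (G4 n)) /\
         (alpha = 1 \/ alpha = 2 -> chi alpha (G4 n) = chi alpha (G5 n))) /\
  (* (5) tetracyclic *)
  (forall n : nat, (6 <= n)%N ->
     tetracyclic (H4 n) /\
     forall e : rel 'I_n, tetracyclic e -> chi alpha e <= chi alpha (H4 n)) /\
  (tetracyclic (H5 5) /\
     forall e : rel 'I_5, tetracyclic e -> chi alpha e <= chi alpha (H5 5)).
Proof.
have mono := natpow_mono halpha; have conv := natpow_convex halpha.
have cone n c (e : rel 'I_n) (n0 : (0 < n)%N) (m : nat) :
    m = (n.-1 + c)%N -> [/\ simple_graph e, connected_graph e & nedges e = m] ->
    exists H : rel 'I_n, [/\ simple_graph H, nedges H = c,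
      forall i, (deg H i <= n - 2)%N &
      chi alpha e <= cone_sum (fun k => k%:R `^ alpha) H].
  by move=> -> [se ce ne]; exact: chi_le_cone.
split; [|split; [|split; [|split; [|split]]]].
- move=> n n0; split.
    have [se ce ne] := @star_plus_cyclic n [::] n0 isT.
    by split => //; rewrite ne /=; lia.
  move=> e [se ce ne].
  have [||H [sH cH _ le_H]] := cone n 0%N e n0 n.-1; first lia.
    by split => //; lia.
  by rewrite chi_Sn //; apply: le_trans le_H _; exact: cone_sum_le0.
- move=> n n3; have n0 : (0 < n)%N by lia.
  split.
    have [|se ce ne] := @star_plus_cyclic n
      [:: (1, 2)]%N n0; first by rewrite /=; lia.
    by split => //; rewrite ne /=; lia.
  move=> e /(cone n 1%N e n0 n) []; first lia.
  move=> H [sH cH _ le_H]; rewrite chi_Snplus //; apply: le_trans le_H _.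
  exact: cone_sum_le1.
- move=> n n4; have n0 : (0 < n)%N by lia.
  split.
    have [|se ce ne] := @star_plus_cyclic n
      [:: (1, 2); (2, 3)]%N n0; first by rewrite /=; lia.
    by split => //; rewrite ne /=; lia.
  move=> e /(cone n 2%N e n0 n.+1) []; first lia.
  move=> H [sH cH _ le_H]; rewrite chi_B1 //; apply: le_trans le_H _.
  exact: cone_sum_le2.
- move=> n n5; have n0 : (0 < n)%N by lia.
  have n0R : 0 < n%:R :> R by rewrite ltr0n.
  (* The terms in [6 ^ alpha] cancel, leaving the third difference of [x ^ alpha] at [n]. *)
  have diff3 : chi alpha (G4 n) - chi alpha (G5 n) =
      (n%:R + 1 + 1 + 1) `^ alpha - 3 * (n%:R + 1 + 1) `^ alpha
        + 3 * (n%:R + 1) `^ alpha - n%:R `^ alpha.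
    by rewrite chi_G4 // chi_G5 1?ltnW // !addnS addn0 -!natr1; ring.
  split; [|split; [|split; [|split; [|split]]]].
  + have [|se ce ne] := @star_plus_cyclic n
      [:: (1, 2); (1, 3); (1, 4)]%N n0; first by rewrite /=; lia.
    by split => //; rewrite ne /=; lia.
  + have [|se ce ne] := @star_plus_cyclic n
      [:: (1, 2); (2, 3); (3, 1)]%N n0; first by rewrite /=; lia.
    by split => //; rewrite ne /=; lia.
  + move=> e /(cone n 3%N e n0 n.+2) []; first lia.
    move=> H [sH cH _ le_H]; rewrite le_max chi_G4 // chi_G5 1?ltnW //.
    have [le4|le5] := cone_sum_le3 mono conv sH cH; apply/orP; [left|right].
      exact: le_trans le_H le4.
    exact: le_trans le_H le5.
  + by move=> /powR_diff3_lt0 /(_ n0R); rewrite -diff3 subr_lt0.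
  + by move=> /powR_diff3_gt0 /(_ n0R); rewrite -diff3 subr_gt0.
  + by move=> /powR_diff3_eq0 /(_ n0R); rewrite -diff3 => /subr0_eq.
- move=> n n6; have n0 : (0 < n)%N by lia.
  split.
    have [|se ce ne] := @star_plus_cyclic n
      [:: (1, 2); (1, 3); (1, 4); (1, 5)]%N n0; first by rewrite /=; lia.
    by split => //; rewrite ne /=; lia.
  move=> e /(cone n 4%N e n0 n.+3) []; first lia.
  move=> H [sH cH _ le_H]; rewrite chi_H4 //; apply: le_trans le_H _.
  by apply: cone_sum_le4 => //; apply: natpow_diff4 => //; lia.
- split.
    have [|se ce ne] := @star_plus_cyclic 5
      [:: (1, 2); (2, 3); (3, 1); (1, 4)]%N isT; first by [].
    by split => //; rewrite ne.
  move=> e /(cone 5%N 4%N e isT 8%N) []; first by [].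
  (* Here [h3] bounds the degrees by [5 - 2 = 3], which excludes the star with four edges. *)
  move=> H [sH cH h3 le_H]; rewrite chi_H5 //; apply: le_trans le_H _.
  exact: cone_sum_le4_deg3.
Qed.
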